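(* For all $n\ge1$ the following identities hold: \begin{enumerate} \item $\displaystyle\sum_{\sigma\in\mathcal{I}_{4n}(123)}(-1)^{\mathrm{maj}(\sigma)}q^{\mathrm{des}(\sigma)}=q\sum_{\sigma\in\mathcal{I}_{2n}(123)}q^{2\,\mathrm{des}(\sigma)}$; \item $\displaystyle\sum_{\sigma\in\mathcal{I}_{4n+2}(123)}(-1)^{\mathrm{maj}(\sigma)}q^{\mathrm{des}(\sigma)}=(1-q)q^2\sum_{\sigma\in\mathcal{I}_{2n}(123)}q^{2\,\mathrm{des}(\sigma)}$; \item $\displaystyle\sum_{\sigma\in\mathcal{I}_{2n+1}(123)}(-1)^{\mathrm{maj}(\sigma)}q^{\mathrm{des}(\sigma)}=(-1)^nq^2\sum_{\sigma\in\mathcal{I}_{n}(123)}q^{2\,\mathrm{des}(\sigma)}$. \end{enumerate}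
   Context: $\mathcal{I}_m(123)$ is the set of involutions $\sigma=\sigma_1\cdots\sigma_m$ of $\{1,\dots,m\}$ with no increasing subsequence of length three. $\mathrm{Des}(\sigma)=\{i:1\le i\le m-1,\ \sigma_i>\sigma_{i+1}\}$, $\mathrm{des}(\sigma)=|\mathrm{Des}(\sigma)|$, $\mathrm{maj}(\sigma)=\sum_{i\in\mathrm{Des}(\sigma)}i$. *)

(* Defs.v *)
From mathcomp Require Import all_boot all_fingroup all_algebra.

Set Implicit Arguments.
Unset Strict Implicit.
Unset Printing Implicit Defensive.

(* Permutations of {1, ..., m} are elements of 'S_m, which act on 'I_m: the
   ordinal i stands for the integer i.+1, both as a position and as a value. *)

Definition is_involution m (s : 'S_m) : bool := [forall i, s (s i) == i].

Definition avoids123 m (s : 'S_m) : bool :=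
  ~~ [exists i : 'I_m, exists j : 'I_m, exists k : 'I_m,
        [&& i < j, j < k, s i < s j & s j < s k]].

Definition I123 m : {set 'S_m} := [set s | is_involution s & avoids123 s].

(* The last ordinal has no successor in 'I_m, so it is never a descent. *)
Definition Des m (s : 'S_m) : {set 'I_m} :=
  [set i : 'I_m | [exists j : 'I_m, (j == i.+1 :> nat) && (s j < s i)]].

Definition des m (s : 'S_m) : nat := #|Des s|.

Definition maj m (s : 'S_m) : nat := \sum_(i in Des s) i.+1.

(* Main.v *)
(* A 123-avoiding involution reverses the set of its left-to-right minima and
   the complementary set, so it is encoded by the word w marking the minima by
   true; its ascents are the peaks of w, the positions of a factor true, false.
   Removing the cycle of the largest letter acts on words by
     true w true -> w   and   true^j false z false -> true^j z  (j >= 1),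
   true^(m-1) false being exceptional, and this recursion shows that the peak sets of the words arising in this way
   are equidistributed with those of all words with uphalf m letters true and
   m./2 letters false. The peak generating function W of the latter, with
   weight x_i for a peak at i, satisfies
     W(a+1, b+1; x) = W(a, b+1; sx) + W(a+1, b; sx) + (x_0 - 1) W(a, b; ssx),
   s being the shift. For the weights x_i = (-1)^(i+1) y two steps of this
   recursion give the same recursion for constant weights y^2, whence
     W(2a, 2b) = W(2a+1, 2b) = W(2a, 2b+1) = W(a, b; y^2),
     W(2a+1, 2b+1) = (1 - y) W(a, b; y^2).
   Descents are the positions that are not ascents, so one takes y = 1/X in the
   fraction field. *)
Require Import Defs.
From mathcomp Require Import all_boot all_fingroup all_algebra.
From mathcomp Require Import zify ring.
Import GRing.Theory.
Local Open Scope ring_scope.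

(** * Sums over binary words and weights of peaks *)

Section Words.
Variable R : comNzRingType.
Implicit Types (x y : nat -> R) (w v z : seq bool) (F G : seq bool -> R).

Definition shift x : nat -> R := fun i => x i.+1.

(** The default [true] keeps a final [true] from being a peak, just as the last position is never an
    ascent. *)
Fixpoint peak_wt x w : R :=
  if w is b :: w' then
    (if b && ~~ head true w' then x 0%N else 1) * peak_wt (shift x) w'
  else 1.

Fixpoint wsum n F : R :=
  if n is n'.+1 then
    wsum n' (fun w => F (true :: w)) + wsum n' (fun w => F (false :: w))
  else F [::].

Lemma eq_wsum n F G :
  (forall w, size w = n -> F w = G w) -> wsum n F = wsum n G.
Proof.
elim: n F G => [|n IHn] F G eqFG /=; first exact: eqFG.
by congr (_ + _); apply: IHn => w sw; apply: eqFG; rewrite /= sw.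
Qed.

Lemma wsumD n F G : wsum n (fun w => F w + G w) = wsum n F + wsum n G.
Proof. by elim: n F G => //= n IHn F G; rewrite !IHn addrACA. Qed.

Lemma wsumZ n c F : wsum n (fun w => c * F w) = c * wsum n F.
Proof. by elim: n F => //= n IHn F; rewrite !IHn mulrDr. Qed.

Lemma wsum0 n : wsum n (fun=> 0) = 0.
Proof. by elim: n => //= n ->; rewrite addr0. Qed.

Lemma wsum_cons n F :
  wsum n.+1 F =
  wsum n (fun w => F (true :: w)) + wsum n (fun w => F (false :: w)).
Proof. by []. Qed.

Lemma wsum_rcons n F :
  wsum n.+1 F =
  wsum n (fun w => F (rcons w true)) + wsum n (fun w => F (rcons w false)).
Proof.
elim: n F => // n IHn F.
rewrite wsum_cons (IHn (fun w => F (true :: w))).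
rewrite (IHn (fun w => F (false :: w))) /=.
exact: addrACA.
Qed.

Lemma wsum_tuple n F : \sum_(t : n.-tuple bool) F t = wsum n F.
Proof.
elim: n F => [|n IHn] F.
  by rewrite (big_pred1 [tuple]) // => t; rewrite [t]tuple0 /= eqxx.
rewrite /= -!IHn.
rewrite (reindex (fun p : bool * n.-tuple bool => [tuple of p.1 :: p.2])) /=.
  rewrite -(pair_bigA _ (fun b (t : n.-tuple bool) => F (b :: t))) /=.
  by rewrite big_bool.
exists (fun t => (thead t, [tuple of behead t])) => [[b t] _|t _] /=.
  by congr (_, _); apply: val_inj.
by rewrite [RHS]tuple_eta; apply: val_inj.
Qed.

Lemma eq_peak_wt x y w : x =1 y -> peak_wt x w = peak_wt y w.
Proof.
elim: w x y => //= b w IHw x y exy; rewrite exy; congr (_ * _).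
by apply: IHw => i; apply: exy.
Qed.

Lemma peak_wt_rcons_true x w : peak_wt x (rcons w true) = peak_wt x w.
Proof.
elim: w x => [|b w IHw] x /=; first by rewrite mulr1.
by rewrite IHw; case: w {IHw}.
Qed.

Lemma peak_wt_rcons_false x w :
  peak_wt x (rcons w false) =
  (if last false w then x (size w).-1 else 1) * peak_wt x w.
Proof.
elim: w x => [|b w IHw] x //=.
rewrite IHw; case: w {IHw} => [|b' w] /=.
  by rewrite andbT andbF !mul1r; case: b.
by rewrite mulrCA; case: (last b' w).
Qed.

Lemma peak_wtE x w :
  peak_wt x w = \prod_(i < size w | nth false w i && ~~ nth true w i.+1) x i.
Proof.
elim: w x => [|b w IHw] x; first by rewrite big_ord0.
rewrite /= big_mkcond big_ord_recl /= nth0; congr (_ * _).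
by rewrite IHw big_mkcond.
Qed.

End Words.

Arguments shift {R} _ _ /.
Arguments peak_wt {R} _ _.
Arguments wsum {R} _ _.

(** * Good words and the reductions that preserve goodness *)

(* The number of letters [true], increased by [k], before each [false]. *)
Fixpoint falls k (w : seq bool) : seq nat :=
  if w is b :: w' then if b then falls k.+1 w' else k :: falls k w' else [::].

Lemma falls_cat k w1 w2 :
  falls k (w1 ++ w2) = falls k w1 ++ falls (k + count id w1) w2.
Proof.
elim: w1 k => [|[] w1 IHw] k /=; rewrite ?addn0 //.
  by rewrite IHw add1n addSnnS.
by rewrite IHw add0n.
Qed.

Lemma size_falls k w : size (falls k w) = count (pred1 false) w.
Proof. by elim: w k => [|[] w IHw] k //=; rewrite IHw. Qed.

Lemma nth_falls k w n : (n < size w)%N -> ~~ nth true w n ->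
  nth 0%N (falls k w) (count (pred1 false) (take n w)) =
  (k + count id (take n w))%N.
Proof.
elim: w k n => [|[] w IHw] k [|n] //=; rewrite ?addn0 // ltnS => lt_n nw.
  by rewrite IHw // addSnnS.
by rewrite IHw.
Qed.

Lemma falls_nseq k j : falls k (nseq j true) = [::].
Proof. by elim: j k => //= j IHj k; rewrite IHj. Qed.

Lemma fallsS k w : falls k.+1 w = map S (falls k w).
Proof. by elim: w k => [|[] w IHw] k //=; rewrite IHw. Qed.

(* Letters [false] at positions p and q exchanged by the reversal of the set of
   such positions are both dominated by a [true] exactly when more letters
   [true] than present in [w] precede p and q altogether. *)
Definition good (w : seq bool) : bool :=
  all (fun p => count id w < p.1 + p.2)%N
      (zip (falls 0 w) (rev (falls 0 w))).

Lemma good_nseq j : good (nseq j true).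
Proof. by rewrite /good falls_nseq. Qed.

Lemma zip_rcons (S T : Type) (s : seq S) (t : seq T) x y :
  size s = size t -> zip (rcons s x) (rcons t y) = rcons (zip s t) (x, y).
Proof. by elim: s t => [|a s IHs] [|b t] //= [e]; rewrite IHs. Qed.

(** Every entry of [falls] rises by one and the count of [true] by two, so each inequality gains two
    on both sides. *)
Lemma good_UU w : good (true :: rcons w true) = good w.
Proof.
rewrite /good /= -cats1 falls_cat /= cats0 fallsS count_cat /= -map_rev.
have -> (s t : seq nat) :
  zip (map S s) (map S t) = map (fun p => (p.1.+1, p.2.+1)) (zip s t).
  by elim: s t => [|a s IHs] [|b t] //=; rewrite IHs.
by rewrite all_map; apply: eq_all => p /=; lia.
Qed.

(** The two new letters [false] pair with each other: their entries add up to [j.+1] more than the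
    total count, so they impose nothing, and the other pairs are unchanged. *)
Lemma good_UDD j w :
  good (nseq j.+1 true ++ false :: rcons w false) = good (nseq j.+1 true ++ w).
Proof.
rewrite /good !falls_cat !falls_nseq !cat0s /= -cats1 falls_cat /= !cats1.
rewrite rev_cons rev_rcons rcons_cons /= zip_rcons ?size_rev //=.
rewrite all_rcons /= -cats1 !count_cat /= count_cat /= !count_nseq.
rewrite !addn0 !mul1n add0n.
rewrite andbA; apply: andb_idl => _; apply/andP; split; lia.
Qed.

Lemma good_UD j : good (nseq j.+1 true ++ [:: false]).
Proof.
by rewrite /good falls_cat falls_nseq count_cat /= count_nseq andbT; lia.
Qed.

Lemma falls_le k w : all (fun i => i <= k + count id w)%N (falls k w).
Proof.
elim: w k => [|[] w IHw] k //=.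
  by rewrite add1n -addSnnS.
by rewrite add0n leq_addr IHw.
Qed.

(** The first entry of [falls] is then [0], and its partner cannot exceed the total count. *)
Lemma good_D w : good (false :: w) = false.
Proof.
rewrite /good /= rev_cons.
have := falls_le 0 w; rewrite add0n; case/lastP: (falls 0 w) => [|s i] //.
rewrite all_rcons => /andP[lei _].
by rewrite rev_rcons /= ltnNge add0n lei.
Qed.

(** * Equidistribution of peaks on good words and on balanced words *)

Section GoodWords.
Variable R : comNzRingType.
Implicit Types (x y : nat -> R) (w v z : seq bool) (G : seq bool -> R).

Definition peak_sum G n x := wsum n (fun w => G w * peak_wt x w).

Lemma eq_peak_sum G1 G2 n x :
  (forall w, size w = n -> G1 w = G2 w) -> peak_sum G1 n x = peak_sum G2 n x.
Proof. by move=> eG; apply: (eq_wsum R n) => w sw; rewrite eG. Qed.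

Lemma peak_sumD G1 G2 n x :
  peak_sum (fun w => G1 w + G2 w) n x = peak_sum G1 n x + peak_sum G2 n x.
Proof. by rewrite /peak_sum -wsumD; apply: eq_wsum => w _; rewrite mulrDl. Qed.

Lemma peak_sum1 G x : peak_sum G 1 x = G [:: true] + G [:: false].
Proof. by rewrite /peak_sum /= !mulr1. Qed.

(** Deleting the first letter loses only a possible peak at [0]; the factor [x 0 - 1] corrects this
    for the words starting with [true], [false]. *)
Lemma peak_sum_cons G n x :
  peak_sum G n.+2 x =
    peak_sum (fun w => G (true :: w)) n.+1 (shift x) +
    peak_sum (fun w => G (false :: w)) n.+1 (shift x) +
    (x 0%N - 1) *
      peak_sum (fun w => G (true :: false :: w)) n (shift (shift x)).
Proof.
rewrite /peak_sum wsum_cons -wsumZ [RHS]addrAC; congr (_ + _); last first.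
  by apply: eq_wsum => w _ /=; rewrite mul1r.
rewrite [LHS]wsum_cons [X in _ = X + _]wsum_cons -[RHS]addrA -[X in _ = _ + X]wsumD.
congr (_ + _).
  by apply: eq_wsum => w _ /=; rewrite mul1r.
by apply: eq_wsum => w _ /=; ring.
Qed.

Lemma peak_sum_rcons G n x :
  peak_sum G n.+2 x =
    peak_sum (fun w => G (rcons w true)) n.+1 x +
    peak_sum (fun w => G (rcons w false)) n.+1 x +
    (x n - 1) * peak_sum (fun w => G (rcons (rcons w true) false)) n x.
Proof.
rewrite /peak_sum wsum_rcons -wsumZ -[RHS]addrA; congr (_ + _).
  by apply: eq_wsum => w _; rewrite peak_wt_rcons_true.
rewrite [LHS]wsum_rcons [X in _ = X + _]wsum_rcons [RHS]addrAC.
rewrite -[X in _ = X + _]wsumD; congr (_ + _); apply: eq_wsum => w sw.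
  rewrite peak_wt_rcons_false last_rcons size_rcons sw peak_wt_rcons_true /=.
  by ring.
by rewrite [in LHS]peak_wt_rcons_false last_rcons mul1r.
Qed.

Let goodU j w : R := (good (nseq j true ++ w))%:R.
Let goodUD j w : R := (good (nseq j true ++ false :: w))%:R.

Let goodU_cons j w : goodU j (true :: w) = goodU j.+1 w.
Proof. by rewrite /goodU; congr (good _)%:R; elim: j => //= j <-. Qed.

Let goodU_rcons j w : goodU j.+1 (rcons w true) = goodU j w.
Proof. by rewrite /goodU /= -rcons_cat good_UU. Qed.

Let goodUD_true j w : goodUD j.+1 (rcons w true) = goodUD j w.
Proof. by rewrite /goodUD /= -rcons_cons -rcons_cat good_UU. Qed.

Let goodUD_false j w : goodUD j.+1 (rcons w false) = goodU j.+1 w.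
Proof. by rewrite /goodUD good_UDD. Qed.

(* The right-hand sides count balanced words with a prefix
   [false^p true^(j-p)], [p] being arbitrary and the prefix being deleted; in
   the second one the next letter is [false] and [p < j]. *)
Lemma good_sums N j n :
  ((j + n <= N)%N -> forall x,
    peak_sum (goodU j) n x =
    peak_sum (fun w =>
      (uphalf (j + n) <= count id w + j <= uphalf (j + n) + j)%N%:R) n x) /\
  ((j + n < N)%N -> forall x,
    peak_sum (goodUD j) n x =
    peak_sum (fun w =>
      (uphalf (j + n).+1 <= count id w + j < uphalf (j + n).+1 + j)%N%:R) n x).
Proof.
elim: N j n => [|N IHN] j n.
  split=> // /[!leqn0] /[!addn_eq0] /andP[/eqP-> /eqP->] x.
  by rewrite /peak_sum /= /goodU /=.
have IHU j' n' : (j' + n' <= N)%N -> _ := fun h => (IHN j' n').1 h.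
have IHD j' n' : (j' + n' < N)%N -> _ := fun h => (IHN j' n').2 h.
(* Once a [false] follows the prefix, the last letter is removed together with a letter before it,
   so the total length drops and the outer induction applies. *)
have CN j' n' : (j' + n' < N.+1)%N -> forall x,
    peak_sum (goodUD j') n' x =
    peak_sum (fun w =>
      (uphalf (j' + n').+1 <= count id w + j' < uphalf (j' + n').+1 + j')%N%:R)
      n' x.
  move=> {j n}; case: j' => [|j] lt_jn x.
    apply: eq_peak_sum => w _; rewrite /goodUD good_D.
    by congr _%:R; lia.
  case: n' lt_jn => [|[|n]] lt_jn.
  - by rewrite /peak_sum /= /goodUD good_UD; congr (_%:R * _); lia.
  - rewrite !peak_sum1 (goodUD_true _ [::]) (goodUD_false _ [::]).
    rewrite /goodU /goodUD cats0 good_nseq.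
    case: j lt_jn => [|j] _; first by rewrite good_D addrC.
    rewrite good_UD -!natrD; congr _%:R => /=; lia.
  rewrite !peak_sum_rcons -!peak_sumD; congr (_ + _ * _).
    under eq_peak_sum => w _ do rewrite goodUD_true goodUD_false.
    rewrite !peak_sumD IHD ?IHU; [|lia|lia].
    (* On both sides two intervals for [count id w] are added; they differ only by an exchange of
       upper ends, so the indicators have equal sums. *)
    rewrite -!peak_sumD; apply: eq_peak_sum => w _.
    by rewrite -?cats1 !count_cat /= -!natrD; congr _%:R; lia.
  under eq_peak_sum => w _ do rewrite goodUD_false goodU_rcons.
  rewrite IHU; last lia.
  by apply: eq_peak_sum => w _; rewrite -?cats1 !count_cat /=; congr _%:R; lia.
split=> [lt_jn x|]; last exact: CN.
(* Moving a first [true] into the prefix keeps [j + n] fixed, hence an inner induction on [n]. *)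
elim: n j x lt_jn => [|n IHn] j x lt_jn.
  rewrite /peak_sum /= /goodU cats0 good_nseq; congr (_%:R * _); lia.
have eU x' n' : peak_sum (fun w => goodU j (true :: w)) n' x' =
    peak_sum (goodU j.+1) n' x'.
  by apply: eq_peak_sum => w _.
case: n IHn lt_jn => [|n] IHn lt_jn.
  rewrite !peak_sum1 goodU_cons.
  have -> : goodU j [:: false] = (0 < j)%:R.
    by rewrite /goodU; case: j {lt_jn eU} => [|j]; rewrite ?good_D ?good_UD.
  rewrite /goodU cats0 good_nseq -!natrD; congr _%:R => /=; lia.
rewrite !peak_sum_cons eU IHn ?CN; [|lia|lia].
under [X in _ * X]eq_peak_sum => w _ do rewrite goodU_cons.
rewrite CN; last lia.
rewrite -!peak_sumD; congr (_ + _ * _); apply: eq_peak_sum => w _.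
  by rewrite /= -!natrD; congr _%:R; lia.
by rewrite /=; congr _%:R; lia.
Qed.
End GoodWords.

(** * Peak sums of balanced words with alternating weights *)

Section Balanced.
Variable R : comNzRingType.
Implicit Types (x : nat -> R) (y : R).

Definition balanced_sum a b x :=
  peak_sum R (fun w => (count id w == a)%:R) (a + b) x.

Lemma good_sum n x :
  peak_sum R (fun w => (good w)%:R) n x =
  balanced_sum (uphalf n) n./2 x.
Proof.
have [/(_ (leqnn n) x) -> _] := good_sums R n 0 n.
rewrite /balanced_sum (_ : uphalf n + n./2 = n)%N; last lia.
by apply: eq_peak_sum => w _; congr _%:R; lia.
Qed.

Lemma eq_balanced_sum x1 x2 a b :
  x1 =1 x2 -> balanced_sum a b x1 = balanced_sum a b x2.
Proof. by move=> ex; apply: eq_wsum => w _; rewrite (eq_peak_wt _ _ _ _ ex). Qed.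

Lemma balanced_sum0 b x : balanced_sum 0 b x = 1.
Proof.
rewrite /balanced_sum /peak_sum; elim: b x => [|b IHb] x.
  by rewrite /= mulr1.
rewrite wsum_cons -[RHS]add0r; congr (_ + _).
  by rewrite -[RHS](wsum0 R b); apply: eq_wsum => w _ /=; rewrite mul0r.
by rewrite -[RHS](IHb (shift x)); apply: eq_wsum => w _ /=; rewrite mul1r.
Qed.

Lemma balanced_sum_0 a x : balanced_sum a 0 x = 1.
Proof.
rewrite /balanced_sum addn0 /peak_sum; elim: a x => [|a IHa] x.
  by rewrite /= mulr1.
rewrite wsum_cons -[RHS]addr0; congr (_ + _); last first.
  rewrite -[RHS](wsum0 R a); apply: eq_wsum => w sw /=.
  by have := count_size id w; case: eqP => [|_ _]; rewrite ?mul0r //; lia.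
rewrite -[RHS](IHa (shift x)); apply: eq_wsum => w sw /=; rewrite add1n eqSS.
case: eqP => [cw|_]; last by rewrite !mul0r.
suff -> : w = nseq (size w) true by case: (size w) => [|k] /=; rewrite !mul1r.
apply/all_pred1P; rewrite (eq_all (a2 := id)); last by case.
by rewrite all_count cw sw.
Qed.

Lemma balanced_sumSS a b x :
  balanced_sum a.+1 b.+1 x =
    balanced_sum a b.+1 (shift x) + balanced_sum a.+1 b (shift x) +
    (x 0%N - 1) * balanced_sum a b (shift (shift x)).
Proof.
by rewrite /balanced_sum addSn addnS addSn peak_sum_cons.
Qed.

Definition alt y : nat -> R := fun i => (-1) ^+ i.+1 * y.

Lemma balanced_sum_altSS a b y :
  balanced_sum a.+1 b.+1 (alt y) =
    balanced_sum a b.+1 (alt (- y)) + balanced_sum a.+1 b (alt (- y)) -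
    (y + 1) * balanced_sum a b (alt y).
Proof.
have shift_alt z : shift (alt z) =1 alt (- z).
  by move=> i; rewrite /alt /= exprS; ring.
rewrite balanced_sumSS !(eq_balanced_sum _ _ _ _ (shift_alt y)).
have -> : alt y 0 - 1 = - (y + 1) by rewrite /alt expr1; ring.
rewrite mulNr; congr (_ - _ * _); apply: eq_balanced_sum => i.
by rewrite /alt /= !exprS; ring.
Qed.

(** Induction on [a], then on [b]. In the even-even case the factor [1 - y] of the odd-odd sum makes
    the correction [- (y + 1) * (1 - y) = y ^+ 2 - 1], which is the one for the constant weight
    [y ^+ 2]. *)
Lemma balanced_sum_alt a b y :
  let c := balanced_sum a b (fun=> y ^+ 2) in
  [/\ balanced_sum a.*2 b.*2 (alt y) = c,
      balanced_sum a.*2.+1 b.*2 (alt y) = c,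
      balanced_sum a.*2 b.*2.+1 (alt y) = c &
      balanced_sum a.*2.+1 b.*2.+1 (alt y) = (1 - y) * c].
Proof.
(* For [a = 0] the sums with a single letter [true] need their own induction. *)
have base b' (y' : R) : balanced_sum 1 b'.*2 (alt y') = 1 /\
    balanced_sum 1 b'.*2.+1 (alt y') = 1 - y'.
  elim: b' y' => [|b' IHb] y'.
    split; first exact: balanced_sum_0.
    by rewrite balanced_sum_altSS !balanced_sum0 balanced_sum_0; ring.
  have e z : balanced_sum 1 b'.+1.*2 (alt z) = 1.
    rewrite doubleS balanced_sum_altSS !balanced_sum0.
    by have [_ ->] := IHb (- z); ring.
  by split=> //; rewrite balanced_sum_altSS !balanced_sum0 e; ring.
elim: a b y => [|a IHa] b y /=.
  by rewrite !balanced_sum0; have [-> ->] := base b y; rewrite mulr1.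
rewrite doubleS; elim: b y => [|b IHb] y.
  rewrite !balanced_sum_0.
  have e z : balanced_sum a.*2.+2 1 (alt z) = 1.
    rewrite balanced_sum_altSS !balanced_sum_0.
    by have [_ _ _ ->] := IHa 0 (- z); rewrite balanced_sum_0; ring.
  by split=> //; rewrite balanced_sum_altSS !balanced_sum_0 e; ring.
have eK z : balanced_sum a.+1 b.+1 (fun=> z ^+ 2) =
    balanced_sum a b.+1 (fun=> z ^+ 2) + balanced_sum a.+1 b (fun=> z ^+ 2) +
    (z ^+ 2 - 1) * balanced_sum a b (fun=> z ^+ 2) by rewrite balanced_sumSS.
have e1 z : balanced_sum a.*2.+2 b.+1.*2 (alt z) =
    balanced_sum a.+1 b.+1 (fun=> z ^+ 2).
  rewrite doubleS balanced_sum_altSS eK -doubleS.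
  have [_ -> _ _] := IHa b.+1 (- z); have [_ _ -> _] := IHb (- z).
  by have [_ _ _ ->] := IHa b z; rewrite sqrrN; ring.
(* The odd-odd sum, taken at [- z], carries a factor [1 + z] that cancels the correction term; [e3]
   works likewise. *)
have e2 z : balanced_sum a.*2.+3 b.+1.*2 (alt z) =
    balanced_sum a.+1 b.+1 (fun=> z ^+ 2).
  rewrite doubleS balanced_sum_altSS -doubleS e1.
  have [_ _ _ ->] := IHb (- z); have [_ _ -> _] := IHb z.
  by rewrite sqrrN; ring.
have e3 z : balanced_sum a.*2.+2 b.+1.*2.+1 (alt z) =
    balanced_sum a.+1 b.+1 (fun=> z ^+ 2).
  rewrite balanced_sum_altSS e1.
  have [_ _ _ ->] := IHa b.+1 (- z); have [_ -> _ _] := IHa b.+1 z.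
  by rewrite sqrrN; ring.
by split=> //; rewrite balanced_sum_altSS e1 e2 e3 sqrrN; ring.
Qed.

End Balanced.

(** * Involutions avoiding 123 as words of left-to-right minima *)

Lemma index_filter (T : eqType) (a : pred T) (e : seq T) x :
  a x -> index x (filter a e) = count a (take (index x e) e).
Proof.
move=> ax; elim: e => //= y e IHe.
have [->|neq_yx] := eqVneq y x; first by rewrite ax /= eqxx.
by case: ifP => /= ay; rewrite ay -?IHe ?(negPf neq_yx).
Qed.

Lemma count_take_le (T : Type) (a : pred T) (e : seq T) n p :
  (n <= p)%N -> (count a (take n e) <= count a (take p e))%N.
Proof.
by move=> le_np; rewrite -(subnKC le_np) takeD count_cat leq_addr.
Qed.

Section LeftToRightMinima.
Variable m : nat.
Implicit Types (s : 'S_m) (t : m.-tuple bool) (i j k : 'I_m) (c : bool).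

Definition color_class t c : seq 'I_m := [seq i <- enum 'I_m | tnth t i == c].

Definition rank t c i := count (pred1 c) (take i t).

Lemma mem_class t c i : (i \in color_class t c) = (tnth t i == c).
Proof. by rewrite mem_filter mem_enum andbT. Qed.

Lemma index_class t i : index i (color_class t (tnth t i)) = rank t (tnth t i) i.
Proof.
rewrite index_filter // index_enum_ord /rank -(map_tnth_enum t).
by rewrite -map_take count_map.
Qed.

Lemma size_class t c : size (color_class t c) = count (pred1 c) t.
Proof. by rewrite size_filter -(map_tnth_enum t) [RHS]count_map. Qed.

(** The colour of [j] is free: [i] itself is counted in the rank of every later position. *)
Lemma ltn_rank t i j : (i < j)%N = (rank t (tnth t i) i < rank t (tnth t i) j)%N.
Proof.
case: (ltnP i j) => [lt_ij|le_ji]; last first.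
  by apply/esym/negbTE; rewrite -leqNgt count_take_le.
apply/esym; apply: leq_trans (count_take_le _ _ _ _ _ lt_ij).
rewrite (take_nth (tnth t i)) ?size_tuple // -cats1 count_cat /=.
by rewrite -tnth_nth eqxx addn1.
Qed.

Lemma rank_onto t c (k : nat) : (k < count (pred1 c) t)%N ->
  exists2 i, tnth t i = c & rank t c i = k.
Proof.
rewrite -size_class => lt_k.
have iP : (k < size (color_class t c))%N -> {i | i = nth i (color_class t c) k}.
  case: (color_class t c) k {lt_k} => [|i e] // k lt_k.
  by exists (nth i (i :: e) k); apply: set_nth_default.
have [i def_i] := iP lt_k.
have /eqP ti : tnth t i == c by rewrite -mem_class def_i mem_nth.
exists i; rewrite // -{1}ti -index_class ti def_i index_uniq //.
by rewrite filter_uniq ?enum_uniq.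
Qed.

Definition reverse_fun t i :=
  nth i (rev (color_class t (tnth t i))) (index i (color_class t (tnth t i))).

Lemma reverse_funP t i (C := color_class t (tnth t i)) :
  tnth t (reverse_fun t i) = tnth t i /\
  index (reverse_fun t i) C = (size C - (index i C).+1)%N.
Proof.
have iC : i \in C by rewrite mem_class.
have lti : (index i C < size C)%N by rewrite index_mem.
rewrite /reverse_fun -/C nth_rev //.
have lti' : (size C - (index i C).+1 < size C)%N by lia.
split; first by apply/eqP; rewrite -mem_class mem_nth.
by rewrite index_uniq // filter_uniq ?enum_uniq.
Qed.

Lemma reverse_funK t : involutive (reverse_fun t).
Proof.
move=> i; have [ci ri] := reverse_funP t i.
have iC : i \in color_class t (tnth t i) by rewrite mem_class.
have lti := iC; rewrite -index_mem in lti.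
have lt_sub a b : (b < a -> a - b.+1 < a)%N by lia.
rewrite {1}/reverse_fun ci ri nth_rev ?lt_sub //.
have e a b : (b < a -> a - (a - b.+1).+1 = b)%N by lia.
rewrite e //.
by rewrite -[RHS](nth_index (reverse_fun t i) iC).
Qed.

Definition reverse_perm t : 'S_m := perm (can_inj (reverse_funK t)).

Lemma color_reverse t i : tnth t (reverse_perm t i) = tnth t i.
Proof. by rewrite permE; have [] := reverse_funP t i. Qed.

Lemma reverse_permK t i : reverse_perm t (reverse_perm t i) = i.
Proof. by rewrite !permE reverse_funK. Qed.

Lemma rank_reverse t i :
  (rank t (tnth t i) i + (rank t (tnth t i) (reverse_perm t i)).+1 =
   count (pred1 (tnth t i)) t)%N.
Proof.
have [ci ri] := reverse_funP t i.
have := index_class t (reverse_fun t i); rewrite ci ri size_class index_class.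
rewrite permE => <-.
have : i \in color_class t (tnth t i) by rewrite mem_class.
rewrite -index_mem size_class index_class; lia.
Qed.

Lemma reverse_perm_decr t i j :
  tnth t i = tnth t j -> (i < j)%N -> (reverse_perm t j < reverse_perm t i)%N.
Proof.
move=> eq_c; rewrite !(ltn_rank t) !color_reverse -eq_c.
have := rank_reverse t i; have := rank_reverse t j; rewrite -eq_c; lia.
Qed.

(** Of three positions two share a colour, and on each colour the reversal decreases. *)
Lemma reverse_perm_I123 t : reverse_perm t \in I123 m.
Proof.
rewrite inE; apply/andP; split; first by apply/forallP=> i; rewrite reverse_permK.
apply/negP=> /existsP[i /existsP[j /existsP[k /and4P[lt_ij lt_jk]]]].
have := reverse_perm_decr t; move: (reverse_perm t) => s decr.
move=> lt_sij lt_sjk.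
have nij : tnth t i <> tnth t j by move=> /decr/(_ lt_ij); lia.
have njk : tnth t j <> tnth t k by move=> /decr/(_ lt_jk); lia.
have nik : tnth t i <> tnth t k by move=> /decr/(_ (ltn_trans lt_ij lt_jk)); lia.
by move: nij njk nik; case: (tnth t i); case: (tnth t j); case: (tnth t k).
Qed.

Definition lrmin s : m.-tuple bool :=
  [tuple [forall j : 'I_m, (j < i)%N ==> (s i < s j)%N] | i < m].

Lemma lrminP s i :
  reflect (forall j, (j < i)%N -> (s i < s j)%N) (tnth (lrmin s) i).
Proof.
rewrite tnth_mktuple.
by apply: (iffP forallP) => h j; [apply/implyP | apply/implyP]; apply: h.
Qed.

Lemma lrminPn s i :
  reflect (exists2 j : 'I_m, (j < i)%N & (s j < s i)%N) (~~ tnth (lrmin s) i).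
Proof.
rewrite tnth_mktuple negb_forall.
apply: (iffP existsP) => [[j]|[j lt_ji lt_s]]; last first.
  by exists j; rewrite negb_imply lt_ji -leqNgt ltnW.
rewrite negb_imply -leqNgt => /andP[lt_ji].
rewrite leq_eqVlt => /orP[/eqP eq_s|].
  by have /perm_inj eq_ji := val_inj eq_s; rewrite eq_ji ltnn in lt_ji.
by exists j.
Qed.

Section Avoiding.
Variable s : 'S_m.
Hypothesis Is : s \in I123 m.

Lemma I123K i : s (s i) = i.
Proof. by move: Is; rewrite inE => /andP[/forallP/(_ i)/eqP]. Qed.

Lemma I123_avoids i j k :
  (i < j)%N -> (j < k)%N -> (s i < s j)%N -> (s j < s k)%N -> False.
Proof.
move=> h1 h2 h3 h4; move: Is; rewrite inE => /andP[_ /negP[]].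
apply/existsP; exists i; apply/existsP; exists j; apply/existsP; exists k.
exact/and4P.
Qed.

(** A left-to-right minimum has no point of the graph to its lower left, a condition symmetric in
    the diagonal, as is the graph of an involution. *)
Lemma color_lrmin i : tnth (lrmin s) (s i) = tnth (lrmin s) i.
Proof.
suff imp j : tnth (lrmin s) j -> tnth (lrmin s) (s j).
  by apply/idP/idP => /imp //; rewrite I123K.
move=> /lrminP lrj; apply/lrminP => k lt_k; rewrite I123K ltnNge.
apply/negP; rewrite leq_eqVlt => /orP[/eqP/val_inj e|/lrj].
  by move: lt_k; rewrite -e I123K ltnn.
by rewrite I123K => /(ltn_trans lt_k); rewrite ltnn.
Qed.

(** An entry that is not a minimum has a smaller one before it, so a larger one after it would
    complete a 123. *)
Lemma lrmin_decr i j :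
  tnth (lrmin s) i = tnth (lrmin s) j -> (i < j)%N -> (s j < s i)%N.
Proof.
move=> e lt_ij; case cj: (tnth (lrmin s) j); first by move/lrminP: cj; apply.
have /lrminPn[k lt_ki lt_s] : ~~ tnth (lrmin s) i by rewrite e cj.
rewrite ltnNge; apply/negP; rewrite leq_eqVlt => /orP[/eqP/val_inj/perm_inj eij|].
  by rewrite eij ltnn in lt_ij.
exact: I123_avoids lt_ki lt_ij lt_s.
Qed.

Lemma reverse_lrmin : reverse_perm (lrmin s) = s.
Proof.
apply/permP => i; rewrite permE /reverse_fun.
set C := color_class _ _.
have sortedC : sorted (fun j k : 'I_m => j < k)%N C.
  apply: sorted_filter; first by move=> x y z; apply: ltn_trans.
  have := iota_ltn_sorted 0 m; rewrite -val_enum_ord sorted_map.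
  by apply: sub_sorted.
(* [s] permutes the class and decreases on it; sorted lists with the same members coincide. *)
have <- : map s C = rev C.
  apply: (canRL revK); apply: (@irr_sorted_eq _ (fun j k : 'I_m => j < k)%N).
  - by move=> x y z; apply: ltn_trans.
  - by move=> x; apply: ltnn.
  - rewrite rev_sorted sorted_map.
    apply: (sub_in_sorted (P := mem C)) sortedC; last exact/allP.
    move=> j k; rewrite !mem_class => /eqP cj /eqP ck lt_jk.
    by apply: lrmin_decr; rewrite ?cj ?ck.
  - exact: sortedC.
  move=> j; rewrite mem_rev; apply/mapP/idP => [[k]|].
    by rewrite !mem_class => /eqP ck ->; rewrite color_lrmin ck.
  move=> jC; exists (s j); last by rewrite I123K.
  by rewrite mem_class color_lrmin -mem_class.
have iC : i \in C by rewrite mem_class.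
by rewrite (nth_map i) ?index_mem // nth_index.
Qed.

(** The bottom of an ascent is a minimum, since 123 is avoided. Conversely, a smaller entry before
    [j] sits at or before [i], hence is at least [s i]. *)
Lemma ascent_lrmin i j : j = i.+1 :> nat ->
  (s i < s j)%N = tnth (lrmin s) i && ~~ tnth (lrmin s) j.
Proof.
move=> eji; have lt_ij : (i < j)%N by rewrite eji.
apply/idP/andP => [lt_s|[/lrminP lri /lrminPn[k lt_kj lt_s]]].
  split; last by apply/lrminPn; exists i.
  apply/negPn/negP => /lrminPn[k lt_ki lt_sk].
  exact: (I123_avoids _ _ _ lt_ki lt_ij lt_sk lt_s).
have [eki|nki] := eqVneq k i; first by rewrite -eki.
apply: ltn_trans lt_s; apply: lri; rewrite ltn_neqAle nki /=.
by rewrite -ltnS -eji.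
Qed.

End Avoiding.

(** The entry of [falls] at index [rank t false i] belongs to [i], and the entry facing it in the
    reversed list to the image of [i]. *)
Lemma goodP t :
  reflect (forall i, ~~ tnth t i ->
             (count id t < rank t true i + rank t true (reverse_perm t i))%N)
          (good t).
Proof.
have size_zipf : size (zip (falls 0 t) (rev (falls 0 t))) = count (pred1 false) t.
  by rewrite size_zip size_rev minnn size_falls.
have count_true e : count (pred1 true) e = count id e.
  by apply: eq_count => -[].
have nthf i : ~~ tnth t i ->
    nth 0%N (falls 0 t) (rank t false i) = rank t true i.
  move=> ti; rewrite nth_falls ?size_tuple //.
    by rewrite add0n /rank count_true.
  by rewrite -tnth_nth.
have rankr i : ~~ tnth t i -> (rank t false i < count (pred1 false) t)%N /\
    (count (pred1 false) t - (rank t false i).+1 =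
     rank t false (reverse_perm t i))%N.
  by move=> /negbTE ti; have := rank_reverse t i; rewrite ti; lia.
apply: (iffP (all_nthP (0, 0)%N)) => [h i ti|h k]; rewrite ?size_zipf.
  have [lt_r eq_r] := rankr _ ti.
  have := h (rank t false i); rewrite size_zipf => /(_ lt_r).
  rewrite nth_zip ?size_rev //= nth_rev ?size_falls // eq_r !nthf //.
  by rewrite color_reverse.
move=> lt_k.
have [i ti ri] : exists2 i, ~~ tnth t i & rank t false i = k.
  by have [i ti ri] := rank_onto _ _ _ lt_k; exists i; rewrite ?ti.
rewrite nth_zip ?size_rev //= nth_rev ?size_falls // -ri.
have [lt_r eq_r] := rankr _ ti.
rewrite eq_r !nthf ?color_reverse //; exact: h.
Qed.

(** Only a [true] before it can dominate a [false] at [i], and the last such is the best candidate,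
    having the lowest image. That image has rank [count id t - rank t true i], which gives the
    inequality of [goodP]. *)
Lemma lrmin_reverse t : (lrmin (reverse_perm t) == t) = good t.
Proof.
have decr := reverse_perm_decr t; have rankr := rank_reverse t.
have lt_rank i j : tnth t i -> (i < j)%N = (rank t true i < rank t true j)%N.
  by move=> ti; rewrite (ltn_rank t) ti.
have count_true e : count (pred1 true) e = count id e.
  by apply: eq_count => -[].
have cr := color_reverse t.
pose dominated i :=
  exists2 j : 'I_m, (j < i)%N & (reverse_perm t j < reverse_perm t i)%N.
have dominatedP i : ~~ tnth t i -> dominated i <->
    (count id t < rank t true i + rank t true (reverse_perm t i))%N.
  move=> ti; split=> [[j lt_ji lt_s]|lt_c].
    have tj : tnth t j.
      apply/negPn/negP => tj.
      have : tnth t j = tnth t i by rewrite (negPf ti) (negPf tj).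
      by move=> /decr/(_ lt_ji); lia.
    have := rankr j; rewrite tj count_true; move: lt_ji lt_s.
    rewrite lt_rank // (lt_rank (reverse_perm t j)) ?cr //; lia.
  have le_r j : (rank t true j <= count id t)%N.
    by rewrite -count_true -(take_size t) count_take_le // size_tuple ltnW.
  (* This is the last [true] before [i]; [lt_c] forces [rank t true i] to be positive. *)
  have [|j tj rj] := rank_onto t true (rank t true i).-1.
    by rewrite count_true; have := le_r i; have := le_r (reverse_perm t i); lia.
  exists j; first by rewrite lt_rank // rj; have := le_r (reverse_perm t i); lia.
  rewrite lt_rank ?cr //; have := rankr j; rewrite tj count_true rj.
  by have := le_r (reverse_perm t i); lia.
apply/eqP/goodP => [e i ti|h].
  by apply/dominatedP => //; apply/lrminPn; rewrite e.
have dom i : ~~ tnth t i -> dominated i by move=> ti; apply/dominatedP/h.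
apply: eq_from_tnth => i; case ti: (tnth t i); last first.
  by apply/negbTE/lrminPn/dom; rewrite ti.
(* If a [true] at [i] were dominated, then by a [false], itself dominated by a [true] at [k]; then
   [k] and [i] would contradict [decr]. *)
apply/negPn/negP => /lrminPn[j lt_ji lt_s].
case tj: (tnth t j); first by have := decr j i; rewrite ti tj; lia.
have [|k lt_kj lt_sk] := dom j; first by rewrite tj.
case tk: (tnth t k); last by have := decr k j; rewrite tk tj; lia.
by have := decr k i; rewrite tk ti; lia.
Qed.

End LeftToRightMinima.

(** [lrmin] and [reverse_perm] are mutually inverse between [I123 m] and the good words. *)
Lemma sum_I123 (R : comNzRingType) m (F : 'S_m -> R) (G : seq bool -> R) :
  (forall s, s \in I123 m -> F s = G (lrmin m s)) ->
  \sum_(s in I123 m) F s = wsum m (fun w => (good w)%:R * G w).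
Proof.
move=> eFG; rewrite (reindex_onto (reverse_perm m) (lrmin m)); last first.
  exact: reverse_lrmin.
rewrite -wsum_tuple big_mkcond; apply: eq_bigr => t _.
rewrite reverse_perm_I123 lrmin_reverse.
case gt: (good t); last by rewrite mul0r.
rewrite mul1r eFG ?reverse_perm_I123 //.
by move: gt; rewrite -lrmin_reverse => /eqP ->.
Qed.

(** * From peaks to descents and the major index *)

Section DescentWeights.
Variable F : fieldType.

(** The ascents are the peaks of the word, so their weights are divided out of the full product. *)
Lemma prod_Des n (c : nat -> F) (s : 'S_n.+1) :
  (forall i, c i != 0) -> s \in I123 n.+1 ->
  \prod_(i in Des s) c i =
  (\prod_(i < n) c i) * peak_wt (fun i => (c i)^-1) (lrmin n.+1 s).
Proof.
move=> c_neq0 Is; have [t et] : {t | t = lrmin _ s} by exists (lrmin _ s).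
rewrite -et.
rewrite peak_wtE -(big_mkord (fun i => nth false t i && ~~ nth true t i.+1)
  (fun i => (c i)^-1)) size_tuple big_mkord.
rewrite (big_ord_widen n.+1 c (leqnSn n)).
rewrite [X in _ = X * _](bigID (fun i => i \in Des s)) /=.
have DesE (i j : 'I_n.+1) : j = i.+1 :> nat -> (i \in Des s) = ~~ (s i < s j)%N.
  move=> eji; rewrite inE -leqNgt.
  apply/existsP/idP => [[k /andP[/eqP eki lt_s]]|le_s].
    by rewrite (_ : j = k) 1?ltnW //; apply: val_inj; rewrite /= eji eki.
  exists j; rewrite eji eqxx ltn_neqAle le_s andbT /=.
  apply: contraTneq (leqnn j) => /val_inj/perm_inj eij.
  by rewrite {1}eji eij ltnn.
rewrite [X in _ = X * _ * _](eq_bigl (fun i => i \in Des s)); last first.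
  move=> i /=; case iD: (i \in Des s); rewrite ?andbF // andbT.
  move: iD; rewrite inE => /existsP[k /andP[/eqP eki _]].
  by rewrite -ltnS -eki ltn_ord.
rewrite [X in _ = _ * X * _](eq_bigl (fun i : 'I_n.+1 =>
  nth false t i && ~~ nth true t i.+1)); last first.
  move=> i /=; rewrite -tnth_nth.
  (* At the last position the default [true] past the end excludes a peak. *)
  have [lt_in|le_ni] := ltnP i n; last first.
    by rewrite (@nth_default _ true) ?size_tuple //= andbF.
  rewrite (DesE i (Ordinal (lt_in : i.+1 < n.+1)%N)) // negbK.
  by rewrite (ascent_lrmin _ _ Is) // -et (tnth_nth true t (Ordinal _)).
rewrite prodfV mulfK //.
by apply/prodf_neq0 => i _.
Qed.

Lemma sum_prod_Des m (c : nat -> F) :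
  (0 < m)%N -> (forall i, c i != 0) ->
  \sum_(s in I123 m) \prod_(i in Des s) c i =
  (\prod_(i < m.-1) c i) *
    balanced_sum F (uphalf m) m./2 (fun i => (c i)^-1).
Proof.
case: m => // m _ c_neq0.
rewrite (sum_I123 _ _ _ (fun w => (\prod_(i < m) c i) *
  peak_wt (fun i => (c i)^-1) w)); last by move=> s; apply: prod_Des.
rewrite -good_sum /peak_sum -wsumZ.
by apply: eq_wsum => w _; rewrite mulrCA.
Qed.

Variable t : F.
Hypothesis t_neq0 : t != 0.

(** The weights [(-1) ^+ i.+1 * t] record both statistics; the sign exponents of all positions add
    up to ['C(m, 2)]. *)
Lemma sum_maj_des m : (0 < m)%N ->
  \sum_(s in I123 m) (-1) ^+ maj s * t ^+ des s =
  (-1) ^+ 'C(m, 2) * t ^+ m.-1 *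
    balanced_sum F (uphalf m) m./2 (alt F t^-1).
Proof.
move=> m_gt0; have eprod (I : finType) (P : pred I) (f : I -> nat) :
    \prod_(i | P i) ((-1) ^+ (f i).+1 * t) =
    (-1) ^+ (\sum_(i | P i) (f i).+1) * t ^+ #|P|.
  by rewrite big_split /= prodrXr prodr_const.
have := sum_prod_Des m (fun i => (-1) ^+ i.+1 * t) m_gt0.
rewrite eprod card_ord => sumE.
under eq_bigr => s _ do rewrite -[_ * _](eprod _ (mem (Des s)) (@nat_of_ord m)).
rewrite sumE => [|i]; last by rewrite mulf_neq0 ?signr_eq0.
congr (_ * _ * _).
  congr (_ ^+ _); rewrite -bin2_sum -(big_mkord xpredT S).
  case: m m_gt0 {sumE} => // m _.
  by rewrite [RHS]big_nat_recl // add0n.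
apply: eq_balanced_sum => i.
by rewrite /alt invfM invr_sign.
Qed.

Lemma sum_double_des m : (0 < m)%N ->
  \sum_(s in I123 m) t ^+ (2 * des s) =
  t ^+ (2 * m.-1) * balanced_sum F (uphalf m) m./2 (fun=> t^-1 ^+ 2).
Proof.
move=> m_gt0; have := sum_prod_Des m (fun=> t ^+ 2) m_gt0.
rewrite prodr_const card_ord -exprM => sumE.
under eq_bigr => s _ do rewrite exprM -prodr_const.
rewrite sumE => [|_]; last by rewrite expf_neq0.
by congr (_ * _); apply: eq_balanced_sum => i; rewrite exprVn.
Qed.

Lemma sum_maj_des_4n n : (0 < n)%N ->
  \sum_(s in I123 (4 * n)) (-1) ^+ maj s * t ^+ des s =
  t * \sum_(s in I123 (2 * n)) t ^+ (2 * des s).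
Proof.
move=> n_gt0; rewrite sum_maj_des ?sum_double_des; [|lia|lia].
rewrite (_ : uphalf (4 * n) = n.*2)%N; last lia.
rewrite (_ : (4 * n)./2 = n.*2)%N; last lia.
have [-> _ _ _] := balanced_sum_alt F n n t^-1.
rewrite (_ : uphalf (2 * n) = n)%N; last lia.
rewrite (_ : (2 * n)./2 = n)%N; last lia.
rewrite (_ : 'C(4 * n, 2) = (n * (4 * n).-1).*2)%N; last first.
  by rewrite bin2; lia.
rewrite -signr_odd odd_double mul1r mulrA -exprS.
by congr (_ ^+ _ * _); lia.
Qed.

Lemma sum_maj_des_4n2 n : (0 < n)%N ->
  \sum_(s in I123 (4 * n + 2)) (-1) ^+ maj s * t ^+ des s =
  (1 - t) * t ^+ 2 * \sum_(s in I123 (2 * n)) t ^+ (2 * des s).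
Proof.
move=> n_gt0; rewrite sum_maj_des ?sum_double_des; [|lia|lia].
rewrite (_ : uphalf (4 * n + 2) = n.*2.+1)%N; last lia.
rewrite (_ : (4 * n + 2)./2 = n.*2.+1)%N; last lia.
have [_ _ _ ->] := balanced_sum_alt F n n t^-1.
rewrite (_ : uphalf (2 * n) = n)%N; last lia.
rewrite (_ : (2 * n)./2 = n)%N; last lia.
(* The odd binomial contributes a sign, and [- (1 - t^-1) = (1 - t) * t^-1]. *)
rewrite (_ : 'C(4 * n + 2, 2) = (n * (4 * n + 3)).*2.+1)%N; last first.
  by rewrite bin2; nia.
rewrite -signr_odd /= odd_double /= expr1.
rewrite (_ : (4 * n + 2).-1 = (2 * (2 * n).-1).+2.+1)%N; last lia.
by rewrite !exprS; field.
Qed.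

Lemma sum_maj_des_2n1 n : (0 < n)%N ->
  \sum_(s in I123 (2 * n + 1)) (-1) ^+ maj s * t ^+ des s =
  (-1) ^+ n * t ^+ 2 * \sum_(s in I123 n) t ^+ (2 * des s).
Proof.
move=> n_gt0; rewrite sum_maj_des ?sum_double_des; [|lia|lia].
rewrite (_ : uphalf (2 * n + 1) = n.+1)%N; last lia.
rewrite (_ : (2 * n + 1)./2 = n)%N; last lia.
have -> : balanced_sum F n.+1 n (alt F t^-1) =
    balanced_sum F (uphalf n) n./2 (fun=> t^-1 ^+ 2).
  (* For odd [n] the pair [n.+1], [n] is even-odd, for even [n] it is odd-even; the halves are
     [uphalf n] and [n./2] either way. *)
  have [nodd|neven] := boolP (odd n).
    have [_ _ eK _] := balanced_sum_alt F n./2.+1 n./2 t^-1.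
    have -> : uphalf n = n./2.+1 by lia.
    by rewrite -eK; congr balanced_sum; lia.
  have [_ eK _ _] := balanced_sum_alt F n./2 n./2 t^-1.
  have -> : uphalf n = n./2 by lia.
  by rewrite -eK; congr balanced_sum; lia.
rewrite (_ : 'C(2 * n + 1, 2) = n + (n * n).*2)%N; last first.
  by rewrite bin2; nia.
rewrite -signr_odd oddD odd_double addbF signr_odd.
rewrite mulrA -[_ * _ * t ^+ _]mulrA -exprD.
by congr (_ * _ ^+ _ * _); lia.
Qed.

End DescentWeights.

Theorem theorem5p3 (n : nat) (hn : (1 <= n)%N) :
  [/\ \sum_(s in I123 (4 * n)) (-1) ^+ maj s * 'X^(des s)
        = 'X * \sum_(s in I123 (2 * n)) 'X^(2 * des s) :> {poly int},
      \sum_(s in I123 (4 * n + 2)) (-1) ^+ maj s * 'X^(des s)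
        = (1 - 'X) * 'X^2 * \sum_(s in I123 (2 * n)) 'X^(2 * des s)
          :> {poly int}
    & \sum_(s in I123 (2 * n + 1)) (-1) ^+ maj s * 'X^(des s)
        = (-1) ^+ n * 'X^2 * \sum_(s in I123 n) 'X^(2 * des s) :> {poly int}].
Proof.
(* The inverse weights live in the fraction field, into which [{poly int}] embeds, so the identities
   can be checked there. *)
have X_neq0 : FracField.tofrac ('X : {poly int}) != 0.
  by rewrite tofrac_eq0 polyX_eq0.
have signE m : \sum_(s in I123 m) (-1) ^+ maj s * FracField.tofrac 'X ^+ des s =
    FracField.tofrac (\sum_(s in I123 m) (-1) ^+ maj s * 'X^(des s) : {poly int}).
  by rewrite rmorph_sum; apply: eq_bigr => s _; rewrite rmorphM !rmorphXn rmorphN1.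
have doubleE m : \sum_(s in I123 m) FracField.tofrac 'X ^+ (2 * des s) =
    FracField.tofrac (\sum_(s in I123 m) 'X^(2 * des s) : {poly int}).
  by rewrite rmorph_sum; apply: eq_bigr => s _; rewrite rmorphXn.
split; apply/eqP; rewrite -tofrac_eq -signE rmorphM /= -doubleE; apply/eqP.
- exact: sum_maj_des_4n.
- rewrite rmorphM rmorphB rmorph1 rmorphXn; exact: sum_maj_des_4n2.
- rewrite rmorphM !rmorphXn rmorphN1; exact: sum_maj_des_2n1.
Qed.
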